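(* Let $\theta_0 \in (0,1)$ (i.e. $\theta_0$ lies in the interior of the parameter space $[0,1]$) and let $X_1,\dots,X_n$ be i.i.d. Bernoulli$(\theta_0)$ random variables, with sample proportion $\bar\theta = \frac1n\sum_{i=1}^n \mathbb{1}(X_i=1)$. Suppose the released differentially private statistic is produced by the additive mechanism $$\hat\pi = \bar\theta + Y,\qquad Y = \frac{\Delta_{\bar\theta}}{\epsilon} Z,\quad \Delta_{\bar\theta}=\frac1n,$$ where $\epsilon>0$ is a fixed privacy budget and $Z$ is a zero-mean, unit-variance random variable with known distribution, independent of the data. Let $\hat\theta$ be the Fiducial Matching (FIMA) random variable defined, conditionally on $\hat\pi$, as follows: draw an independent copy $Y^*$ of $Y$ and set $\tilde\theta^* = \hat\pi - Y^*$; if $\tilde\theta^*>1$ set $\hat\theta = 1-\delta$; if $\tilde\theta^*<0$ set $\hat\theta=\delta$; otherwise draw $U_1^*,\dots,U_n^*$ i.i.d. $U(0,1)$ with order statistics $U^*_{[1]}\le\dots\le U^*_{[n]}$ (with the conventions $U^*_{[0]}:=\delta$ and $U^*_{[n+1]}:=1-\delta$), let $a = U^*_{[\lfloor n\tilde\theta^*\rfloor]}$, $b=U^*_{[\lfloor n\tilde\theta^*+1\rfloor]}$, and set $\hat\theta = a + D(b-a)$, where $D$ is an independent random variable supported on $[0,1]$; here $0<\delta\ll1$ is a fixed small constant. For $\alpha\in(0,1)$ define the conditional quantile $$\hat\theta_\alpha := \inf\{v\in\mathbb{R} : \mathbb{P}(\hat\theta\le v \mid \hat\pi)\ge \alpha\}.$$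 Then, as $n\to\infty$, $$\mathbb{P}(\theta_0 \le \hat\theta_\alpha) = \alpha + o_p(1).$$
   Context: $\hat\theta$ is a (randomized) solution of the matching problem $\hat\theta \in \mathrm{argzero}_{\theta\in[0,1]}[\hat\pi - \hat\pi^*(\theta)]$, where $\hat\pi^*(\theta)=\bar\theta^*(\theta)+Y^*$ and $\bar\theta^*(\theta)=\frac1n\sum_{i=1}^n\mathbb{1}(U_i^*\le\theta)$ is the empirical CDF of the simulated uniforms; the value is drawn from the interval $F_{U^*}^{-1}(\tilde\theta^* )$ of solutions. Typical choices: $Z\sim\mathrm{Laplace}(0,1)$ (pure $\epsilon$-DP) or $Z\sim N(0,1)$. *)

(* Defs.v *)
From HB Require Import structures.
From mathcomp Require Import all_boot all_order all_algebra.
From mathcomp Require Import all_classical all_reals all_analysis.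
Set Implicit Arguments.
Unset Strict Implicit.
Unset Printing Implicit Defensive.
Import Order.TTheory GRing.Theory Num.Theory.
Local Open Scope classical_set_scope.
Local Open Scope ring_scope.

(* Mutual independence of a finite family of real random variables:
   the product rule for every family of Borel sets (taking some B i = setT
   gives the product rule for every subfamily). *)
Definition mutually_independent {d} {T : measurableType d} {R : realType}
  (P : probability T R) (I : finType) (Xs : I -> T -> R) : Prop :=
  forall B : I -> set R, (forall i, measurable (B i)) ->
    P (\bigcap_(i in [set: I]) (Xs i @^-1` B i)) =
    (\prod_(i : I) P (Xs i @^-1` B i))%E.

Definition has_law {d} {T : measurableType d} {R : realType}
  (P : probability T R) (X : T -> R) (mu : set R -> \bar R) : Prop :=
  forall A : set R, measurable A -> P (X @^-1` A) = mu A.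

Definition bernoulli_rv {d} {T : measurableType d} {R : realType}
  (P : probability T R) (X : T -> R) (p : R) : Prop :=
  P (X @^-1` [set 1]) = p%:E /\ P (X @^-1` [set 0]) = (1 - p)%:E.

Definition uniform01_rv {d} {T : measurableType d} {R : realType}
  (P : probability T R) (U : T -> R) : Prop :=
  has_law P U (fun A => lebesgue_measure (A `&` `[0, 1]%classic)).

(* Order statistic U*_[k] of us : 'I_n -> R, with U*_[0] := delta and
   U*_[k] := 1 - delta for k >= n+1 (only k = n+1 is ever used). *)
Definition ostat {R : realType} (n : nat) (delta : R) (us : 'I_n -> R)
  (k : nat) : R :=
  if k == 0%N then delta
  else if (n < k)%N then 1 - delta
  else nth 0 (sort <=%R [seq us i | i <- enum 'I_n]) k.-1.

(* FIMA draw theta_hat as a function of pi_hat, Y*, the uniforms U* and D.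
   In the branch 0 <= theta_tilde, floor(x) = truncn(x) for x = n*theta_tilde
   and x = n*theta_tilde + 1 (both nonnegative). *)
Definition fima_value {R : realType} (n : nat) (delta : R)
  (pihat ystar : R) (us : 'I_n -> R) (dd : R) : R :=
  let tt := pihat - ystar in
  if 1 < tt then 1 - delta
  else if tt < 0 then delta
  else
    let a := ostat delta us (Num.truncn (n%:R * tt)) in
    let b := ostat delta us (Num.truncn (n%:R * tt + 1)) in
    a + dd * (b - a).

Definition sample_prop {R : realType} {T} (n : nat) (X : 'I_n -> T -> R)
  (w : T) : R :=
  n%:R^-1 * \sum_(i < n) (X i w == 1)%:R.

Definition data_family {R : realType} {T} (n : nat) (Z : T -> R)
  (X : 'I_n -> T -> R) : option 'I_n -> T -> R :=
  fun k => match k with None => Z | Some i => X i end.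

Definition sim_family {R : realType} {T} (n : nat) (Zs : T -> R)
  (U : 'I_n -> T -> R) (D : T -> R) : option (option 'I_n) -> T -> R :=
  fun k => match k with
           | None => D
           | Some None => Zs
           | Some (Some i) => U i end.

(* Main.v *)
(* Write S for the number of ones in the data, N for the number of simulated
   uniforms below theta0, C = Z / eps, and C' for the simulated copy of C.  Away
   from the edges, n theta_tilde = S + C - C' and theta_hat lies between two
   consecutive order statistics of the uniforms, so theta_hat <= theta0 is the
   event N + C' > S + C up to an error of one unit in the count.  Now V = S + C
   and N + C' have the same law, and this law gives mass at most
   m(n) = max_s P(Bin(n, theta0) = s) to any half-open unit interval.  Hence
   P(theta_hat <= theta0 | pihat) is, up to m(n), the survival function of V
   evaluated at V, whose law is uniform up to m(n) again.  The edge events have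
   small probability: the noise is tight, and S is within k of 0 or n with
   probability O(k m(n)).  So everything reduces to m(n) --> 0, and no central
   limit theorem is needed. *)
Require Import Defs.
From HB Require Import structures.
From mathcomp Require Import all_boot all_order all_algebra.
From mathcomp Require Import all_classical all_reals all_analysis.
From mathcomp Require Import measurable_realfun.
From mathcomp Require Import ring lra zify.
Set Implicit Arguments.
Unset Strict Implicit.
Unset Printing Implicit Defensive.
Import Order.TTheory GRing.Theory Num.Theory numFieldNormedType.Exports.
Local Open Scope classical_set_scope.
Local Open Scope ring_scope.

(** * Atoms of the binomial law *)

Definition binpmf {R : realType} (p : R) (n s : nat) : R :=
  'C(n, s)%:R * p ^+ s * (1 - p) ^+ (n - s).

(** This is the m(n) of the overview. For 0 < p < 1 the atoms are nonnegative, so starting the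
    maximum at 0 does not alter it. *)
Definition binmax {R : realType} (p : R) (n : nat) : R :=
  \big[Num.max/0]_(s < n.+1) binpmf p n s.

Section Binomial.
Context {R : realType} (p : R).
Hypothesis p01 : 0 < p < 1.

Lemma binpmf_small n s : (n < s)%N -> binpmf p n s = 0.
Proof. by move=> ns; rewrite /binpmf bin_small// !mul0r. Qed.

Lemma binpmf_ge0 n s : 0 <= binpmf p n s.
Proof.
move: p01 => /andP[p0 p1].
by rewrite /binpmf mulr_ge0 ?mulr_ge0 ?ler0n ?exprn_ge0 ?subr_ge0
  ?(ltW p0) ?(ltW p1).
Qed.

Lemma binmax_ge0 n : 0 <= binmax p n.
Proof. by rewrite /binmax; exact: bigmax_ge_id. Qed.

Lemma binpmf_le_binmax n s : binpmf p n s <= binmax p n.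
Proof.
have [ns|sn] := ltnP n s; first by rewrite binpmf_small// binmax_ge0.
by rewrite -ltnS in sn; exact: (le_bigmax 0 _ (Ordinal sn)).
Qed.

Lemma sum_binpmf n : \sum_(s < n.+1) binpmf p n s = 1.
Proof.
transitivity ((1 - p + p) ^+ n); last by rewrite subrK expr1n.
rewrite exprDn; apply: eq_bigr => i _.
by rewrite /binpmf -mulr_natl; ring.
Qed.

Lemma binpmf0 n : binpmf p n.+1 0 = (1 - p) * binpmf p n 0.
Proof. by rewrite /binpmf !bin0 !subn0 exprS; ring. Qed.

Lemma binpmfS n s :
  binpmf p n.+1 s.+1 = p * binpmf p n s + (1 - p) * binpmf p n s.+1.
Proof.
rewrite /binpmf binS natrD subSS exprS.
have [sn|ns] := ltnP s n; first by rewrite -(subnSK sn) !exprS; ring.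
by rewrite (bin_small (m := s.+1))//; ring.
Qed.

(** By Pascal's rule an atom at n + 1 is an average, with weights p and 1 - p, of two neighbouring
    atoms at n (of one atom and 0 at the left end). *)
Lemma binmax_leS n : binmax p n.+1 <= binmax p n.
Proof.
move: p01 => /andP[p0 p1].
apply: bigmax_le => [|[[|s] _] _ /=]; first exact: binmax_ge0.
  rewrite binpmf0 (le_trans _ (binpmf_le_binmax n 0))//.
  by rewrite ler_piMl ?binpmf_ge0// gerBl ltW.
rewrite binpmfS; have := binpmf_le_binmax n s; have := binpmf_le_binmax n s.+1.
by nra.
Qed.

Lemma binmax_eq n : exists s, binmax p n = binpmf p n s.
Proof.
have [|s _ E] := @eq_bigmax _ _ _ 0 (@ord0 n) xpredT (fun s => binpmf p n s) isT.
  by move=> i _; exact: binpmf_ge0.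
by exists s; rewrite /binmax E.
Qed.

(* If the maxima stay near m, then maximal atoms at time n+1 force the two
   neighbouring atoms at time n, of which they are convex combinations, to be
   almost maximal too; iterating, r + 1 consecutive atoms are close to m. *)
Lemma binpmf_plateau (m : R) (r : nat) : 0 < m -> binmax p @ \oo --> m ->
  forall e, 0 < e -> \forall n \near \oo,
    exists2 k, (r <= k)%N & forall j, (j <= r)%N -> m - e < binpmf p n (k - j).
Proof.
move: p01 => /andP[p0 p1] m0 cm.
have [q0 q1] : 0 < 1 - p /\ 1 - p < 1 by lra.
have maxm e : 0 < e -> \forall n \near \oo, `|m - binmax p n| < e.
  by move=> e0; move/cvgrPdist_lt : cm; exact.
elim: r => [e e0|r IH e e0].
  near=> n; have [k kE] := binmax_eq n; exists k => // j; rewrite leqn0 => /eqP ->.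
  rewrite subn0 -kE.
  have : `|m - binmax p n| < e by near: n; exact: maxm.
  by rewrite ltr_norml => /andP[]; lra.
pose c := p * (1 - p).
have c0 : 0 < c by rewrite mulr_gt0.
(* If one of the two averaged atoms were at most m - e, the average would drop by at least c e,
   while the available slack is below 2 e'. The minimum with m serves the left end, where one of the
   averaged terms is 0. *)
pose e' := Num.min e m * c / 4.
have e'0 : 0 < e' by rewrite !mulr_gt0// lt_min e0 m0.
have e'e : 4 * e' <= e * c.
  by rewrite /e' mulrC divfK ?pnatr_eq0// ler_pM2r// ge_min lexx.
have e'm : 4 * e' <= m * c.
  by rewrite /e' mulrC divfK ?pnatr_eq0// ler_pM2r// ge_min lexx orbT.
(* The induction hypothesis is read at n + 1 and the conclusion at n: one step back in time
   lengthens the window by one. *)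
have [N _ IHN] := IH _ e'0.
near=> n.
have [k rk Hk] : exists2 k, (r <= k)%N &
    forall j, (j <= r)%N -> m - e' < binpmf p n.+1 (k - j).
  by apply: (IHN n.+1); apply: leqW; near: n; exact: nbhs_infty_ge.
have mn s : binpmf p n s < m + e'.
  have := binpmf_le_binmax n s.
  have : `|m - binmax p n| < e' by near: n; exact: maxm.
  by rewrite ltr_norml => /andP[]; lra.
rewrite /c in e'e e'm.
have step s : m - e' < binpmf p n.+1 s.+1 ->
    m - e < binpmf p n s /\ m - e < binpmf p n s.+1.
  rewrite binpmfS => h; have := mn s; have := mn s.+1 => h1 h2.
  have epq : e * (p * (1 - p)) <= e * p /\ e * (p * (1 - p)) <= e * (1 - p).
    by split; rewrite ler_pM2l//; nra.
  have p1e' : p * e' < e' by rewrite -[ltRHS]mul1r ltr_pM2r.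
  have q1e' : (1 - p) * e' < e' by rewrite -[ltRHS]mul1r ltr_pM2r.
  have ph1 := ler_wpM2l (ltW p0) (ltW h2).
  have qh2 := ler_wpM2l (ltW q0) (ltW h1).
  split; rewrite ltNge; apply/negP => h3.
    have ph3 := ler_wpM2l (ltW p0) h3.
    by move: epq.1 e'e h ph3 qh2 q1e'; rewrite !mulrDr; lra.
  have qh3 := ler_wpM2l (ltW q0) h3.
  by move: epq.2 e'e h qh3 ph1 p1e'; rewrite !mulrDr; lra.
(* The atom at 0 is 1 - p times a single atom, hence too far below m; so the window stops short of 0
   and can grow to the left. *)
have rk' : (r < k)%N.
  rewrite ltn_neqAle rk andbT; apply/eqP => kr.
  have := Hk r (leqnn r); rewrite kr subnn binpmf0 => h.
  have := ler_wpM2l (ltW q0) (ltW (mn 0%N)).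
  have q1e' : (1 - p) * e' < e' by rewrite -[ltRHS]mul1r ltr_pM2r.
  have : m * (p * (1 - p)) <= m * p by rewrite ler_pM2l//; nra.
  by move: h e'm; rewrite !mulrDr; lra.
exists k => // j jr.
have [|rj] := leqP j r.
  move=> {}jr; have := Hk j jr.
  have -> : (k - j = (k - j.+1).+1)%N by lia.
  by case/step.
have -> : j = r.+1 by lia.
have := Hk r (leqnn r).
have -> : (k - r = (k - r.+1).+1)%N by lia.
by case/step.
Unshelve. all: by end_near.
Qed.

(** The maxima decrease to some m >= 0. If m > 0, a plateau of r + 1 atoms above m / 2 would carry
    more than the total mass 1. *)
Lemma cvg_binmax : binmax p @ \oo --> (0 : R).
Proof.
have lb : has_lbound (range (binmax p)).
  by exists 0 => _ [n _ <-]; exact: binmax_ge0.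
have ni : nonincreasing_seq (binmax p).
  by apply/nonincreasing_seqP; exact: binmax_leS.
have cm : binmax p @ \oo --> limn (binmax p) by exact: nonincreasing_is_cvgn.
suff lim0 : limn (binmax p) = 0 by rewrite -lim0.
set m := limn (binmax p) in cm *.
have m_ge0 : 0 <= m.
  by apply: limr_ge; [exact: cvgP cm | exact: nearW binmax_ge0].
apply/eqP; rewrite eq_le m_ge0 andbT leNgt; apply/negP => m0.
(* This choice gives (r + 1) m / 2 > 1. *)
pose r := Num.truncn (2 / m).
have m2 : 0 < m / 2 by lra.
have [N _ /(_ N (leqnn N)) [k rk Hk]] := binpmf_plateau r m0 cm m2.
have : \sum_(j < r.+1) binpmf p N (k - j) <= 1.
  have -> : \sum_(j < r.+1) binpmf p N (k - j) =
            \sum_(k - r <= s < k.+1) binpmf p N s.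
    rewrite big_nat_rev/= -{1}[(k - r)%N]add0n big_addn big_mkord.
    have -> : (k.+1 - (k - r) = r.+1)%N by lia.
    by apply: eq_bigr => j _; congr binpmf; have := ltn_ord j; lia.
  (* No bound of k by N is at hand, so the range runs to the larger of the two; the atoms beyond N
     vanish. *)
  apply: (@le_trans _ _ (\sum_(0 <= s < (maxn N k).+1) binpmf p N s)).
    rewrite (@big_cat_nat _ _ _ (k - r)%N 0%N (maxn N k).+1)//=; last by lia.
    rewrite (@big_cat_nat _ _ _ k.+1 (k - r)%N (maxn N k).+1)//=; [|lia|lia].
    rewrite addrA -[leLHS]add0r -[leLHS]addr0 !lerD// sumr_ge0// => i _;
      exact: binpmf_ge0.
  rewrite (@big_cat_nat _ _ _ N.+1 0%N (maxn N k).+1)//=; last by lia.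
  rewrite [X in _ + X]big_nat_cond [X in _ + X]big1 ?addr0 ?big_mkord ?sum_binpmf// => i.
  by move=> /andP[/andP[Ni _] _]; exact: binpmf_small.
apply/negP; rewrite -ltNge.
apply: (@lt_le_trans _ _ (\sum_(j < r.+1) (m / 2))).
  rewrite sumr_const card_ord -mulr_natl.
  have := truncnS_gt (2 / m); rewrite -/r ltr_pdivrMr//; lra.
by apply: ler_sum => j _; have := Hk j (leq_ord j); lra.
Qed.

End Binomial.

(** * Counts perturbed by independent noise *)

(** The predicate is kept general: it is [x == 1] for the data, and both [x <= theta0] and
    [x < theta0] for the simulated uniforms. *)
Definition hits {R : realType} (a : pred R) (n : nat) (xs : 'I_n -> R) : nat :=
  #|[set i | a (xs i)]%SET|.

Lemma measure_fin_disjoint_bigcup {d} {T : measurableType d} {R : realType}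
    (mu : {measure set T -> \bar R}) (I : finType) (Q : pred I)
    (F : I -> set T) :
  (forall i, measurable (F i)) ->
  (forall i j w, F i w -> F j w -> i = j) ->
  (mu (\bigcup_(i in [set` Q]) F i) = \sum_(i | Q i) mu (F i))%E.
Proof.
move=> mF dF; rewrite measure_fin_bigcup.
- rewrite [RHS]bigfs//; first exact: index_enum_uniq.
  by move=> i _; rewrite mem_index_enum.
- exact: finite_finpred.
- by move=> i j _ _ [w [Fi Fj]]; exact: dF Fi Fj.
- by [].
Qed.

Lemma big_option (R : Type) (idx : R) (op : Monoid.com_law idx) (I : finType)
    (F : option I -> R) :
  \big[op/idx]_k F k = op (F None) (\big[op/idx]_i F (Some i)).
Proof.
rewrite (bigD1 None)//=; congr (op _ _).
rewrite (reindex_omap Some id)/=; last by case.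
by apply: eq_bigl => i; rewrite eqxx.
Qed.

Lemma measurable_set_bool {d} {T : measurableType d} (f : T -> bool) :
  measurable_fun setT f -> measurable [set w | f w].
Proof.
move=> mf; have := mf measurableT [set true] I; rewrite setTI.
by rewrite preimage_true.
Qed.

Lemma measurable_bool_set {d} {T : measurableType d} (f : T -> bool) :
  measurable [set w | f w] -> measurable_fun setT f.
Proof.
by move=> mf; apply: (measurable_fun_bool true); rewrite setTI preimage_true.
Qed.

Lemma natr_hits {R : realType} (a : pred R) (n : nat) (xs : 'I_n -> R) :
  (hits a xs)%:R = \sum_(i < n) (a (xs i))%:R :> R.
Proof.
rewrite /hits -sum1_card natr_sum big_mkcond/=.
by apply: eq_bigr => i _; rewrite inE; case: (a _).
Qed.

Lemma measurable_hits {d} {T : measurableType d} {R : realType} (n : nat)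
    (a : pred R) (us : 'I_n -> T -> R) :
  measurable [set x | a x] -> (forall i, measurable_fun setT (us i)) ->
  measurable_fun setT (fun w => (hits a (us^~ w))%:R : R).
Proof.
move=> ma mus; under eq_fun do rewrite natr_hits.
apply: measurable_sum => i.
rewrite (_ : (fun _ => _) = fun w => if a (us i w) then 1 else 0); last first.
  by apply/funext => w; case: (a _).
apply: measurable_fun_ifT => //.
apply: measurable_bool_set.
by have := mus i measurableT _ ma; rewrite setTI.
Qed.

Section CountLaw.
Context {d} {T : measurableType d} {R : realType} (P : probability T R).
Variables (n : nat) (Z : {mfun T >-> R}) (X : 'I_n -> {mfun T >-> R}).
Variables (a : pred R) (p : R).
Hypothesis a_meas : measurable [set x | a x].
Hypothesis indep :
  mutually_independent P (data_family Z (fun i => X i : T -> R)).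
Hypothesis X_prob : forall i, P [set w | a (X i w)] = p%:E.

(** Fixing the whole set of successes, and not only its size, makes the event a rectangle, to which
    the product rule applies directly. *)
Let pattern (J : {set 'I_n}) (B : set R) : set T :=
  [set w | [set i | a (X i w)]%SET = J /\ B (Z w)].

Let pattern_rect (J : {set 'I_n}) (B : set R) (k : option 'I_n) : set R :=
  match k with
  | None => B
  | Some i => if i \in J then [set x | a x] else ~` [set x | a x]
  end.

Let patternE J B : pattern J B =
  \bigcap_(k in setT) (data_family Z (fun i => X i : T -> R) k
                         @^-1` pattern_rect J B k).
Proof.
apply/seteqP; split => [w [/setP wJ Bw] [i|] _ //=|w h].
  by have := wJ i; rewrite inE => <-; case: ifP => /= // ->.
split; last exact: (h None).
apply/setP => i; rewrite inE; have := h (Some i) I => /=.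
by case: ifP => _ /=; [|move/negP/negbTE].
Qed.

Let pattern_rect_meas J B k : measurable B -> measurable (pattern_rect J B k).
Proof.
by move=> mB; case: k => //= i; case: ifP => // _; exact: measurableC.
Qed.

Let pattern_meas J B : measurable B -> measurable (pattern J B).
Proof.
move=> mB; rewrite patternE; apply: fin_bigcap_measurable; first exact: finite_finset.
move=> k _; rewrite -[X in measurable X]setTI.
by case: k => [i|]; apply: measurable_funP => //; exact: pattern_rect_meas.
Qed.

Let pattern_prob J B : measurable B ->
  P (pattern J B) = ((p ^+ #|J| * (1 - p) ^+ (n - #|J|))%:E * P (Z @^-1` B))%E.
Proof.
move=> mB; rewrite patternE indep; last first.
  by move=> k; exact: pattern_rect_meas.
rewrite big_option/= muleC; congr (_ * _)%E.
rewrite (eq_bigr (fun i => (if i \in J then p else 1 - p)%:E)); last first.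
  move=> i _; case: ifP => _; first exact: X_prob.
  rewrite preimage_setC probability_setC ?X_prob//.
  exact: (measurable_funPTI (X i) a_meas).
rewrite prodEFin (bigID (mem J))/=; congr (_ * _)%:E.
  by rewrite -prodr_const; apply: eq_bigr => i ->.
transitivity (\prod_(i in ~: J) (1 - p)).
  by apply: eq_big => i; [rewrite inE|move=> /negbTE ->].
by rewrite prodr_const cardsCs finset.setCK card_ord.
Qed.

(** The event splits into 'C(n, s) disjoint patterns of equal probability. The product form also
    gives the independence of count and noise. *)
Lemma hits_prob s B : measurable B ->
  P [set w | hits a (fun i => X i w) = s /\ B (Z w)] =
  ((binpmf p n s)%:E * P (Z @^-1` B))%E.
Proof.
move=> mB.
have -> : [set w | hits a (fun i => X i w) = s /\ B (Z w)] =
    \bigcup_(J in [set` [pred J : {set 'I_n} | #|J| == s]]) pattern J B.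
  apply/seteqP; split => [w [/eqP ws Bw]|w [J /eqP Js [wJ Bw]]].
    by exists [set i | a (X i w)]%SET.
  by split=> //; rewrite /hits wJ.
rewrite measure_fin_disjoint_bigcup; last 2 first.
- by move=> J; exact: pattern_meas.
- by move=> J J' w [<- _] [<- _].
rewrite (eq_bigr (fun=> (p ^+ s * (1 - p) ^+ (n - s))%:E * P (Z @^-1` B)))%E; last first.
  by move=> J /eqP <-; exact: pattern_prob.
have /fineK <- : P (Z @^-1` B) \is a fin_num by
    apply: fin_num_measure; exact: (measurable_funPTI Z).
rewrite sumEFin sumr_const -EFinM; congr EFin.
rewrite /binpmf -!mulrA [RHS]mulr_natl; congr (_ *+ _).
by rewrite -[in RHS](card_ord n) -card_draws cardsE.
Qed.

Lemma hits_atom s :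
  (P [set w | hits a (fun i => X i w) = s] <= (binmax p n)%:E)%E.
Proof.
have := hits_prob s measurableT; rewrite preimage_setT probability_setT mule1.
have -> : [set w | hits a (fun i => X i w) = s /\ [set: R] (Z w)] =
          [set w | hits a (fun i => X i w) = s].
  by apply/seteqP; split => w //= [].
by move=> ->; rewrite lee_fin; exact: binpmf_le_binmax.
Qed.

Let hits_meas (Q : pred nat) : measurable [set w | Q (hits a (fun i => X i w))].
Proof.
have -> : [set w | Q (hits a (fun i => X i w))] =
    \bigcup_(J in [set` [pred J : {set 'I_n} | Q #|J|]]) pattern J setT.
  apply/seteqP; split => [w Qw|w [J QJ [wJ _]]].
    by exists [set i | a (X i w)]%SET.
  by rewrite /= /hits wJ.
apply: fin_bigcup_measurable; first exact: finite_finset.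
by move=> J _; exact: pattern_meas.
Qed.

(** Only the K atoms 0, ..., K - 1 contribute, each at most m(n). The next lemma is the mirror image
    at n. *)
Lemma hits_low K : (P [set w | (hits a (fun i => X i w) < K)%N] <=
  (K%:R * binmax p n)%:E)%E.
Proof.
elim: K => [|K IH].
  by rewrite mul0r (_ : [set _ | _] = set0) ?measure0//; apply/seteqP; split.
have -> : [set w | (hits a (fun i => X i w) < K.+1)%N] =
    [set w | (hits a (fun i => X i w) < K)%N] `|`
    [set w | hits a (fun i => X i w) == K].
  apply/seteqP; split => w /=; last by move=> [/ltnW|/eqP ->]; rewrite ltnS.
  by rewrite ltnS leq_eqVlt => /orP[]; [right|left].
apply: (le_trans (measureU2 _ (hits_meas (fun s => (s < K)%N))
  (hits_meas (eq_op^~ K)))).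
rewrite -natr1 mulrDl mul1r EFinD leeD//.
rewrite (_ : [set _ | _] = [set w | hits a (fun i => X i w) = K]) ?hits_atom//.
by apply/seteqP; split => w /= /eqP.
Qed.

Lemma hits_high K : (P [set w | (n < hits a (fun i => X i w) + K)%N] <=
  (K%:R * binmax p n)%:E)%E.
Proof.
elim: K => [|K IH].
  rewrite mul0r (_ : [set _ | _] = set0) ?measure0//.
  apply/seteqP; split => w //=; rewrite addn0 ltnNge => /negP; apply.
  by rewrite /hits -[leqRHS]card_ord max_card.
apply: (@le_trans _ _ (P ([set w | (n < hits a (fun i => X i w) + K)%N] `|`
    [set w | hits a (fun i => X i w) == (n - K)%N]))).
  apply: le_measure; rewrite ?inE.
  - exact: (hits_meas (fun s => (n < s + K.+1)%N)).
  - apply: measurableU; first exact: (hits_meas (fun s => (n < s + K)%N)).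
    exact: (hits_meas (eq_op^~ (n - K)%N)).
  - by move=> w /= h; apply/orP; lia.
apply: (le_trans (measureU2 _ (hits_meas (fun s => (n < s + K)%N))
  (hits_meas (eq_op^~ (n - K)%N)))).
rewrite -natr1 mulrDl mul1r EFinD leeD//.
rewrite (_ : [set _ | _ == _] = [set w | hits a (fun i => X i w) = (n - K)%N]) ?hits_atom//.
by apply/seteqP; split => w /= /eqP.
Qed.

Variables (muZ : probability R R) (c : R).
Hypothesis Z_law : has_law P Z muZ.

Let shift_meas (A : set R) (x : R) : measurable A ->
  measurable [set z | A (x + c * z)].
Proof.
move=> mA; have mf : measurable_fun setT (fun z : R => x + c * z).
  by apply: measurable_funD => //; exact: measurable_funM.
by have := mf measurableT _ mA; rewrite setTI.
Qed.

(** The right-hand side depends only on n, p, c and [muZ]. This is how the noisy count of the data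
    and that of the uniforms, living on different spaces, are seen to have the same law. *)
Lemma noisy_hits_law (A : set R) : measurable A ->
  (P [set w | A ((hits a (fun i => X i w))%:R + c * Z w)%R] =
   \sum_(s < n.+1) (binpmf p n s)%:E * muZ [set z | A (s%:R + c * z)%R])%E.
Proof.
move=> mA.
pose F (s : 'I_n.+1) := [set w | hits a (fun i => X i w) = s /\
  [set z | A (s%:R + c * z)] (Z w)].
have -> : [set w | A ((hits a (fun i => X i w))%:R + c * Z w)] =
    \bigcup_(s in [set` xpredT]) F s.
  apply/seteqP; split => [w Aw|w [s _ [/= ->]]//].
  have hn : (hits a (fun i => X i w) < n.+1)%N.
    by rewrite ltnS /hits -[leqRHS]card_ord max_card.
  by exists (Ordinal hn).
rewrite measure_fin_disjoint_bigcup; last 2 first.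
- move=> s; have -> : F s = [set w | hits a (fun i => X i w) == s] `&`
      Z @^-1` [set z | A (s%:R + c * z)].
    by apply/seteqP; split => w /= [/eqP].
  apply: measurableI; first exact: (hits_meas (eq_op^~ (s : nat))).
  by apply: (measurable_funPTI Z); exact: shift_meas.
- by move=> s s' w [hs _] [hs' _]; apply: ord_inj; rewrite -hs -hs'.
apply: eq_bigr => s _; rewrite -Z_law; last exact: shift_meas.
by apply: hits_prob; exact: shift_meas.
Qed.

(* For a fixed value of the noise, at most one count lies in a half-open
   interval of length one. *)
Lemma noisy_hits_concentration (t : R) : 0 < p < 1 ->
  (P [set w | (t - 1 < (hits a (fun i => X i w))%:R + c * Z w <= t)%R] <=
   (binmax p n)%:E)%E.
Proof.
move=> p01.
pose A := [set x : R | t - 1 < x <= t].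
have mA : measurable A.
  by rewrite (_ : A = `]t - 1, t]%classic)//; apply/seteqP; split => x /=; rewrite in_itv.
rewrite (noisy_hits_law mA).
apply: (@le_trans _ _
  (\sum_(s < n.+1) (binmax p n)%:E * muZ [set z | A (s%:R + c * z)%R])%E).
  by apply: lee_sum => s _; rewrite lee_wpmul2r// lee_fin; exact: binpmf_le_binmax.
rewrite -ge0_sume_distrr//.
rewrite -[leRHS]mule1 lee_wpmul2l ?lee_fin ?binmax_ge0//.
rewrite -(@measure_fin_disjoint_bigcup _ _ _ muZ _ xpredT
  (fun s : 'I_n.+1 => [set z | A (s%:R + c * z)])).
- by apply: probability_le1; apply: fin_bigcup_measurable; [exact: finite_finset|
    move=> s _; exact: shift_meas].
- by move=> s; exact: shift_meas.
move=> s s' z /= /andP[h1 h2] /andP[h3 h4]; apply/val_inj => /=.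
suff : ((s < s'.+1) && (s' < s.+1))%N by lia.
by rewrite -!(ltr_nat R) -!natr1; lra.
Qed.

End CountLaw.

(** * Quantiles *)

Lemma measure_bigcup_le {d} {T : measurableType d} {R : realType}
    (mu : {measure set T -> \bar R}) (F : nat -> set T) (u : \bar R) :
  (forall k, measurable (F k)) -> nondecreasing_seq F ->
  (forall k, mu (F k) <= u)%E -> (mu (\bigcup_k F k) <= u)%E.
Proof.
move=> mF ndF Fu.
have cF := nondecreasing_cvg_mu (mu := mu) mF (bigcupT_measurable _ mF) ndF.
rewrite -(cvg_lim _ cF)//; apply: lime_le; first exact: cvgP cF.
exact: nearW.
Qed.

Lemma measure_bigcap_ge {d} {T : measurableType d} {R : realType}
    (P : probability T R) (F : nat -> set T) (u : \bar R) :
  (forall k, measurable (F k)) -> nonincreasing_seq F ->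
  (forall k, u <= P (F k))%E -> (u <= P (\bigcap_k F k))%E.
Proof.
move=> mF niF Fu.
have F0 : (P (F 0%N) < +oo)%E.
  by rewrite (le_lt_trans (probability_le1 _ (mF _)))// ltry.
have cF := nonincreasing_cvg_mu F0 mF (bigcapT_measurable mF) niF.
rewrite -(cvg_lim _ cF)//; apply: lime_ge; first exact: cvgP cF.
exact: nearW.
Qed.

Lemma ler_subr_natinv {R : realType} (x y : R) :
  (forall k : nat, x - k.+1%:R^-1 < y) -> x <= y.
Proof.
move=> h; rewrite leNgt; apply/negP => yx.
have xy0 : 0 < x - y by rewrite subr_gt0.
have := h (Num.truncn (x - y)^-1).
have := truncnS_gt (x - y)^-1.
move: (_.+1) => N hN.
have N0 : 0 < N%:R :> R by apply: lt_trans hN; rewrite invr_gt0.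
rewrite ltNge => /negP; apply.
have : N%:R^-1 < x - y by rewrite invf_plt.
lra.
Qed.

Section SurvivalQuantile.
Context {d} {T : measurableType d} {R : realType} (P : probability T R).
Variables (V : T -> R) (m u : R).
Hypothesis mV : measurable_fun setT V.
Hypothesis u01 : 0 < u < 1.
Hypothesis V_conc : forall t, (P [set w | (t - 1 < V w <= t)%R] <= m%:E)%E.

Let mlt x : measurable [set w | x < V w].
Proof. by apply: measurable_set_bool; exact: measurable_fun_ltr. Qed.

(** The point x0 is the infimum of the x with P(V > x) <= u. Right continuity puts x0 in this set,
    left limits give P(V >= x0) >= u, and the concentration bound controls the jump at x0. Read at x
    = V, the survival function evaluated at V is at most u with probability between u and u + m. *)
Lemma survival_quantile : exists x0 : R,
  [/\ forall x, (P [set w | (x < V w)%R] <= u%:E)%E <-> x0 <= x,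
      (u%:E <= P [set w | (x0 <= V w)%R])%E &
      (P [set w | (x0 <= V w)%R] <= (u + m)%:E)%E].
Proof.
move: u01 => /andP[u0 u1].
pose S := [set x | (P [set w | (x < V w)%R] <= u%:E)%E].
have S_up x y : x <= y -> S x -> S y.
  move=> xy; apply: le_trans; apply: le_measure; rewrite ?inE//.
  by move=> w /=; exact: le_lt_trans.
(* Otherwise the tails V > k, which decrease to the empty set, would all keep mass at least u; the
   lower bound for S is dual. *)
have S0 : S !=set0.
  apply: contrapT => nS.
  suff : (u%:E <= P (\bigcap_(k : nat) [set w | (k%:R < V w)%R]))%E.
    rewrite (_ : \bigcap_k _ = set0) ?measure0 ?lee_fin ?leNgt ?u0//.
    apply/seteqP; split => w //= /(_ (Num.truncn (V w)).+1 I) /=.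
    by rewrite ltNge (ltW (truncnS_gt _)).
  apply: measure_bigcap_ge => // [k l kl|k].
    by apply/subsetPset => w /=; apply: le_lt_trans; rewrite ler_nat.
  by rewrite leNgt; apply/negP => /ltW h; apply: nS; exists k%:R.
have Slb : has_lbound S.
  apply: contrapT => nS.
  suff : (P (\bigcup_(k : nat) [set w | (- k%:R < V w)%R]) <= u%:E)%E.
    rewrite (_ : \bigcup_k _ = setT).
      by rewrite probability_setT lee_fin leNgt u1.
    apply/seteqP; split => w //= _; exists (Num.truncn (- V w)).+1 => //=.
    by rewrite ltrNl truncnS_gt.
  apply: measure_bigcup_le => // [k l kl|k].
    by apply/subsetPset => w /=; apply: le_lt_trans; rewrite lerN2 ler_nat.
  rewrite leNgt; apply/negP => h; apply: nS; exists (- k%:R) => x Sx.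
  rewrite leNgt; apply/negP => /ltW xk.
  by have := S_up _ _ xk Sx; rewrite /S/= leNgt h.
pose x0 := inf S.
have Sx0 : S x0.
  rewrite /S/= (_ : [set w | _] =
      \bigcup_(k : nat) [set w | x0 + k.+1%:R^-1 < V w]).
    apply: measure_bigcup_le => // [k l kl|k].
      apply/subsetPset => w /=; apply: le_lt_trans.
      by rewrite lerD2l lef_pV2 ?posrE// ler_nat ltnS.
    have k0 : 0 < k.+1%:R^-1 :> R by rewrite invr_gt0.
    have [y Sy yx] := inf_adherent k0 (conj S0 Slb).
    by apply: S_up Sy; exact: ltW.
  apply/seteqP; split => w /=.
    move=> xV; apply: contrapT => nw.
    suff : V w <= x0 by rewrite leNgt xV.
    apply: ler_subr_natinv => k; rewrite ltrBlDr ltNge; apply/negP => h.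
    apply: nw; exists k.+1 => //=; apply: lt_le_trans h.
    by rewrite ltrD2l ltf_pV2 ?posrE// ltr_nat.
  by move=> [k _ /=]; apply: le_lt_trans; rewrite lerDl invr_ge0.
have SE x : S x <-> x0 <= x.
  by split => [Sx|x0x]; [exact: ge_inf|exact: S_up x0x Sx0].
exists x0; split => //.
  rewrite (_ : [set w | _] = \bigcap_(k : nat) [set w | x0 - k.+1%:R^-1 < V w]).
    apply: measure_bigcap_ge => // [k l kl|k].
      apply/subsetPset => w /=; apply: le_lt_trans.
      by rewrite lerD2l lerN2 lef_pV2 ?posrE// ler_nat ltnS.
    rewrite leNgt; apply/negP => /ltW /(SE (x0 - k.+1%:R^-1)).
    by rewrite leNgt ltrBlDr ltrDl invr_gt0 ltr0n.
  apply/seteqP; split => w /=.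
    by move=> h k _ /=; apply: lt_le_trans h; rewrite ltrBlDr ltrDl invr_gt0 ltr0n.
  by move=> h; apply: ler_subr_natinv => k; exact: h.
have mint : measurable [set w | x0 - 1 < V w <= x0].
  apply: measurable_set_bool; apply: measurable_and.
    exact: measurable_fun_ltr.
  exact: measurable_fun_ler.
apply: (@le_trans _ _ (P ([set w | x0 < V w] `|` [set w | x0 - 1 < V w <= x0]))).
  apply: le_measure; rewrite ?inE//.
  - by apply: measurable_set_bool; exact: measurable_fun_ler.
  - exact: measurableU.
  - move=> w /=; rewrite le_eqVlt => /orP[/eqP <-|]; last by left.
    by right; rewrite lexx andbT ltrBlDr ltrDl.
apply: (le_trans (measureU2 _ (mlt _) mint)).
by rewrite EFinD; apply: leeD; [exact: Sx0|exact: V_conc].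
Qed.

End SurvivalQuantile.

(** * Order statistics *)

(** In a sorted list the entries satisfying a downward closed predicate form an initial segment. *)
Lemma nth_sorted_count {R : realType} (a : pred R) (s : seq R) (k : nat) :
  (forall x y, x <= y -> a y -> a x) -> sorted <=%R s -> (k < size s)%N ->
  a (nth 0 s k) = (k < count a s)%N.
Proof.
move=> a_down; elim: s k => [//|x s IH] k /= xs ks.
have s_sorted : sorted <=%R s by exact: path_sorted xs.
have x_min : all (<=%R x) s by exact: (order_path_min le_trans xs).
case: k ks => [_|k ks] /=.
  case: (boolP (a x)) => //= nax; rewrite add0n; apply/esym/negbTE.
  rewrite -leqNgt leqn0 -leqn0 leqNgt -has_count -all_predC.
  apply/allP => y ys /=; apply: contra nax; apply: a_down.
  by move/allP : x_min; apply.
rewrite IH//; case: (boolP (a x)) => //= nax.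
have -> : count a s = 0%N.
  apply/eqP; rewrite -leqn0 leqNgt -has_count -all_predC.
  apply/allP => y ys /=; apply: contra nax; apply: a_down.
  by move/allP : x_min; apply.
by rewrite !ltn0.
Qed.

Section OrderStatistics.
Context {R : realType} (n : nat) (delta : R).
Implicit Types (us : 'I_n -> R) (a : pred R).

(** This translates order statistics into counts. A downward closed predicate covers strict and
    large inequalities at once, and the range of k avoids the two boundary conventions. *)
Lemma ostat_pred us a k : (forall x y, x <= y -> a y -> a x) ->
  (0 < k <= n)%N -> a (ostat delta us k) = (k <= hits a us)%N.
Proof.
move=> a_down /andP[k0 kn].
rewrite /ostat gtn_eqF// ltnNge kn/= nth_sorted_count//; first last.
- by rewrite size_sort size_map size_enum_ord prednK.
- exact: sort_le_sorted.
rewrite prednK// count_sort count_map /hits -sum1_card -sum1_count big_enum_cond.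
by congr (_ <= _)%N; apply: eq_bigl => i; rewrite !inE.
Qed.

(** At least k + 1 samples, hence at least k, do not exceed the order statistic of rank k + 1. *)
Lemma ostat_leS us k : (0 < k < n)%N -> ostat delta us k <= ostat delta us k.+1.
Proof.
move=> /andP[k0 kn].
pose a := <= ostat delta us k.+1.
have a_down x y : x <= y -> a y -> a x by exact: le_trans.
change (a (ostat delta us k)); rewrite ostat_pred ?k0 1?ltnW//.
have : a (ostat delta us k.+1) by rewrite /a/=.
by rewrite ostat_pred//; exact: ltnW.
Qed.

(** This serves measurability: the right-hand side involves neither sorting nor truncation, only
    comparisons of x with constants and with a count. *)
Lemma lt_ostat_truncn us (x v : R) : 0 <= x ->
  (v < ostat delta us (Num.truncn x)) =
  (if x < 1 then v < delta else if n.+1%:R <= x then v < 1 - delta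
   else (hits (<= v) us).+1%:R <= x).
Proof.
move=> x0; have := truncn_le_nat x 0; rewrite leqn0 => <-.
have := truncn_le_nat x n; rewrite leNgt => <-; rewrite -ltnNge.
have := truncn_le_nat x (hits (<= v) us); rewrite leNgt => <-.
set k := Num.truncn x.
have [k0|k0] := eqVneq k 0%N; first by rewrite /ostat k0.
have [nk|kn] := ltnP n k; first by rewrite /ostat (negbTE k0) nk.
rewrite ltNge; congr (~~ _).
change ((<= v) (ostat delta us k) = (k <= hits (<= v) us)%N).
rewrite ostat_pred// ?lt0n ?k0// => y z yz zv; exact: le_trans zv.
Qed.

Context (pihat ystar dd x : R) (us : 'I_n -> R) (a : pred R).
Hypothesis a_down : forall x y, x <= y -> a y -> a x.
Hypothesis n0 : (0 < n)%N.
Hypothesis x_def : n%:R * (pihat - ystar) = x.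
Hypothesis x1n : 1 <= x < n%:R.
Hypothesis dd01 : 0 <= dd <= 1.

Let nR0 : 0 < n%:R :> R. Proof. by rewrite ltr0n. Qed.

Let k := Num.truncn x.

Let kn : (0 < k < n)%N.
Proof.
move: x1n => /andP[x1 xn]; rewrite ltnNge truncn_le_nat -leNgt x1/=.
by rewrite truncn_lt_nat// (le_trans ler01).
Qed.

Let fimaE : fima_value delta pihat ystar us dd = ostat delta us k +
  dd * (ostat delta us k.+1 - ostat delta us k).
Proof.
move: x1n => /andP[x1 xn].
have tt : pihat - ystar = x / n%:R by rewrite -x_def mulrC mulKf// gt_eqF.
rewrite /fima_value x_def tt ltr_pdivlMr// mul1r ltNge (ltW xn)/=.
have xn0 : 0 <= x / n%:R.
  by apply: divr_ge0; [exact: le_trans ler01 x1|exact: ltW].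
rewrite ltNge xn0/=.
congr (_ + _ * (ostat _ _ _ - _)).
apply: truncn_def; have := truncn_itv (le_trans ler01 x1); rewrite -/k -!natr1.
by lra.
Qed.

(** The draw is at least the order statistic of rank k = floor(x), so at least k samples satisfy
    [a], and k > x - 1. *)
Lemma fima_value_ge : a (fima_value delta pihat ystar us dd) ->
  x - 1 < (hits a us)%:R.
Proof.
move=> h; have ak : a (ostat delta us k).
  apply: a_down h; rewrite fimaE lerDl mulr_ge0 ?subr_ge0 ?ostat_leS//.
  by case/andP : dd01.
rewrite ostat_pred// in ak; last by move: kn => /andP[-> /ltnW].
rewrite ltrBlDr natr1; apply: lt_le_trans (truncnS_gt x) _.
by rewrite ler_nat ltnS.
Qed.

(** A count above x is at least k + 1, so the order statistic of rank k + 1 satisfies [a], and the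
    draw lies below it. Between the two implications one unit of the count is lost. *)
Lemma fima_value_le : x < (hits a us)%:R ->
  a (fima_value delta pihat ystar us dd).
Proof.
move=> h; have ak : a (ostat delta us k.+1).
  rewrite ostat_pred//; last by case/andP : kn.
  rewrite ltnNge; apply/negP => hk; move: h; rewrite ltNge => /negP; apply.
  move: x1n => /andP[x1 _].
  have /andP[kx _] := truncn_itv (le_trans ler01 x1).
  by apply: le_trans kx; rewrite ler_nat.
apply: a_down ak; rewrite fimaE; have := ostat_leS us kn.
move: dd01 => /andP[]; nra.
Qed.

End OrderStatistics.

(** * Measurability of order statistics and of the fiducial draw *)

Section Measurability.
Context {d} {T : measurableType d} {R : realType} (n : nat) (delta : R).

(** The maximum with 0 provides the sign condition of [lt_ostat_truncn] everywhere; it changes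
    nothing in the branch of [fima_value] that uses order statistics. *)
Lemma measurable_ostat_truncn (us : 'I_n -> T -> R) (x : T -> R) :
  (forall i, measurable_fun setT (us i)) -> measurable_fun setT x ->
  measurable_fun setT
    (fun w => ostat delta (us^~ w) (Num.truncn (Num.max 0 (x w)))).
Proof.
move=> mus mx; have mx0 : measurable_fun setT (fun w => Num.max 0 (x w)).
  exact: measurable_maxr.
move=> mT; apply: (measurability _ (RGenOInfty.measurableE R)) => //.
move=> _ [_ [v ->] <-]; rewrite setTI.
rewrite (_ : _ @^-1` _ =
    [set w | v < ostat delta (us^~ w) (Num.truncn (Num.max 0 (x w)))]);
  last by apply/seteqP; split => w /=; rewrite in_itv/= andbT.
apply: measurable_set_bool.
have x0 w : 0 <= Num.max 0 (x w) by rewrite le_max lexx.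
under eq_fun do rewrite lt_ostat_truncn//.
apply: measurable_fun_ifT; [exact: measurable_fun_ltr|exact: measurable_cst|].
apply: measurable_fun_ifT; [exact: measurable_fun_ler|exact: measurable_cst|].
apply: measurable_fun_ler => //.
under eq_fun do rewrite -natr1.
apply: measurable_funD => //; apply: measurable_hits => //.
by rewrite (_ : [set _ | _] = `]-oo, v]%classic)//; apply/seteqP; split => y /=; rewrite in_itv.
Qed.

Lemma measurable_fima_value (us : 'I_n -> T -> R) (f g dd : T -> R) :
  (forall i, measurable_fun setT (us i)) -> measurable_fun setT f ->
  measurable_fun setT g -> measurable_fun setT dd ->
  measurable_fun setT (fun w => fima_value delta (f w) (g w) (us^~ w) (dd w)).
Proof.
move=> mus mf mg mdd.
pose tt w := f w - g w.
pose A w := ostat delta (us^~ w) (Num.truncn (Num.max 0 (n%:R * tt w))).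
pose B w := ostat delta (us^~ w) (Num.truncn (Num.max 0 (n%:R * tt w + 1))).
have mtt : measurable_fun setT tt by exact: measurable_funB.
have mA : measurable_fun setT A.
  by apply: measurable_ostat_truncn => //; exact: measurable_funM.
have mB : measurable_fun setT B.
  apply: measurable_ostat_truncn => //; apply: measurable_funD => //.
  exact: measurable_funM.
rewrite (_ : (fun w => _) = fun w => if 1 < tt w then 1 - delta else
    if tt w < 0 then delta else A w + dd w * (B w - A w)).
  apply: measurable_fun_ifT; [exact: measurable_fun_ltr|exact: measurable_cst|].
  apply: measurable_fun_ifT; [exact: measurable_fun_ltr|exact: measurable_cst|].
  apply: measurable_funD => //; apply: measurable_funM => //.
  exact: measurable_funB.
apply/funext => w; rewrite /fima_value -/(tt w).
case: ifP => // _; case: ltP => // tt0.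
rewrite /A /B !max_r// ?addr_ge0// mulr_ge0//.
Qed.

End Measurability.

(** * Coverage for a fixed sample size *)

(** The variable D is dropped by assigning it the whole line as Borel set. *)
Lemma mutually_independent_sim_data {d} {T : measurableType d} {R : realType}
    (P : probability T R) (n : nat) (Zs : T -> R) (U : 'I_n -> T -> R)
    (D : T -> R) :
  mutually_independent P (sim_family Zs U D) ->
  mutually_independent P (data_family Zs U).
Proof.
move=> indep B mB.
pose B' k := if k is Some k' then B k' else setT.
have := indep B' _; rewrite big_option/= probability_setT mul1e.
have -> : \bigcap_(i in setT) (sim_family Zs U D i @^-1` B' i) =
    \bigcap_(i in setT) (data_family Zs U i @^-1` B i).
  apply/seteqP; split => w h [i|] _ //=.
  - exact: (h (Some (Some i)) I).
  - exact: (h (Some None) I).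
  - by case: i => [i|]; [exact: (h (Some i) I)|exact: (h None I)].
move=> ->; last by case => //=; exact: measurableT.
by apply: eq_bigr => -[].
Qed.

(** The boolean selects the open or the closed right end: the upper bound on coverage uses the
    former, the lower bound the latter. *)
Lemma uniform01_itv {d} {T : measurableType d} {R : realType}
    (P : probability T R) (U : T -> R) (p : R) (b : bool) :
  uniform01_rv P U -> 0 < p < 1 ->
  P (U @^-1` [set` Interval -oo%O (BSide b p)]) = p%:E.
Proof.
move=> unifU /andP[p0 p1]; rewrite unifU//.
have -> : [set` Interval -oo%O (BSide b p)] `&` `[0, 1]%classic =
    [set` Interval (BLeft 0) (BSide b p)] :> set R.
  apply/seteqP; split => x /=; rewrite !in_itv/=.
    by case: b => /= -[-> /andP[->]].
  case: b => /= /andP[-> xp]; split => //=.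
    by rewrite (ltW (lt_trans xp p1)).
  by rewrite (le_trans xp (ltW p1)).
by rewrite lebesgue_measure_itv/= lte_fin p0 sube0.
Qed.

(** Tightness of the noise: the tails decrease to the empty set. *)
Lemma tail_small {R : realType} (mu : probability R R) (c e : R) : 0 < e ->
  exists K : nat, (mu [set z | (K%:R <= `|c * z|)%R] <= e%:E)%E.
Proof.
move=> e0; apply: contrapT => nK.
suff : (e%:E <= mu (\bigcap_(K : nat) [set z | (K%:R <= `|c * z|)%R]))%E.
  rewrite (_ : \bigcap_K _ = set0) ?measure0 ?lee_fin ?leNgt ?e0//.
  apply/seteqP; split => z //= /(_ (Num.truncn `|c * z|).+1 I) /=.
  by rewrite leNgt truncnS_gt.
apply: measure_bigcap_ge => [k|k l kl|k].
- apply: measurable_set_bool; apply: measurable_fun_ler => //.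
  by apply: measurableT_comp => //; exact: measurable_funM.
- by apply/subsetPset => z /=; apply: le_trans; rewrite ler_nat.
- by rewrite leNgt; apply/negP => /ltW h; apply: nK; exists k.
Qed.

(* The positivity of [theta] excludes the junk value [inf A = 0] of a set
   without infimum. *)
Lemma le_quantile {R : realType} (G : R -> R) (theta alpha : R) :
  {homo G : x y / x <= y} -> (exists v, alpha <= G v) -> 0 < theta ->
  theta <= inf [set v | alpha <= G v] <->
  forall k : nat, G (theta - k.+1%:R^-1) < alpha.
Proof.
move=> G_homo [v0 Gv0] theta0; split => [le_inf k|h].
  rewrite ltNge; apply/negP => Gk.
  have [lbS|nlb] := pselect (has_lbound [set v | alpha <= G v]).
    have := le_trans le_inf (ge_inf lbS Gk).
    by rewrite leNgt ltrBlDr ltrDl invr_gt0 ltr0n.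
  by move: le_inf; rewrite inf_out ?leNgt ?theta0// => -[].
apply: lb_le_inf; first by exists v0.
move=> v Gv; apply: ler_subr_natinv => k; rewrite ltNge; apply/negP => vk.
by have := le_trans Gv (G_homo _ _ vk); rewrite leNgt h.
Qed.

Section FixedSampleSize.
Context {R : realType} (theta0 eps alpha delta : R) (n : nat).
Context (muZ muD : probability R R).
Context {d1 : measure_display} {T1 : measurableType d1} (P1 : probability T1 R).
Context (X : 'I_n -> {mfun T1 >-> R}) (Z : {mfun T1 >-> R}).
Context {d2 : measure_display} {T2 : measurableType d2} (P2 : probability T2 R).
Context (Zs : {mfun T2 >-> R}) (U : 'I_n -> {mfun T2 >-> R}).
Context (Dv : {mfun T2 >-> R}).
Hypothesis theta0_01 : 0 < theta0 < 1.
Hypothesis alpha_01 : 0 < alpha < 1.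
Hypothesis n0 : (0 < n)%N.
Hypothesis D_supp : muD `[0, 1]%classic = 1%E.
Hypothesis data_indep :
  mutually_independent P1 (data_family Z (fun i => X i : T1 -> R)).
Hypothesis X_law : forall i, bernoulli_rv P1 (X i) theta0.
Hypothesis Z_law : has_law P1 Z muZ.
Hypothesis sim_indep :
  mutually_independent P2 (sim_family Zs (fun i => U i : T2 -> R) Dv).
Hypothesis Zs_law : has_law P2 Zs muZ.
Hypothesis U_law : forall i, uniform01_rv P2 (U i).
Hypothesis D_law : has_law P2 Dv muD.

Let fima (pi : R) (w : T2) : R :=
  fima_value delta pi ((n%:R^-1 / eps) * Zs w) (fun i => U i w) (Dv w).

Let G (pi v : R) : R := fine (P2 [set w | fima pi w <= v]).

Let pihat (w : T1) : R :=
  sample_prop (fun i => X i : T1 -> R) w + (n%:R^-1 / eps) * Z w.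

Let covered : set T1 :=
  [set w | theta0 <= inf [set v : R | alpha <= G (pihat w) v]].

Let S (w : T1) : nat := hits (fun x : R => x == 1) (fun i => X i w).
(** [V] is n pihat, and [Vs] is its simulated counterpart, a count of uniforms plus the fresh noise
    on the same scale. *)
Let V (w : T1) : R := (S w)%:R + eps^-1 * Z w.
Let Vs (a : pred R) (w : T2) : R :=
  (hits a (fun i => U i w))%:R + eps^-1 * Zs w.

Let nR0 : 0 < n%:R :> R. Proof. by rewrite ltr0n. Qed.

Let pihatE w : n%:R * pihat w = V w.
Proof.
rewrite /pihat /V /S /sample_prop natr_hits mulrDr mulVKf ?gt_eqF//.
by rewrite -!mulrA mulVKf ?gt_eqF.
Qed.

(** Joint measurability makes [G] measurable in its first argument, as the measure of the sections
    of a measurable set. *)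
Let meas_fima : measurable_fun setT (fun z : R * T2 => fima z.1 z.2).
Proof.
have m1 : measurable_fun setT (fst : R * T2 -> R) by exact: measurable_fst.
have m2 (f : {mfun T2 >-> R}) : measurable_fun setT (fun z : R * T2 => f z.2).
  by apply: measurableT_comp => //; exact: measurable_snd.
apply: (@measurable_fima_value _ (R * T2)%type R n delta
  (fun i z => U i z.2) fst (fun z => n%:R^-1 / eps * Zs z.2) (fun z => Dv z.2)) => //.
by apply: measurable_funM => //; exact: m2.
Qed.

Let meas_fima_pi pi : measurable_fun setT (fima pi).
Proof.
apply: (measurableT_comp meas_fima (measurable_fun_pair _ _)) => //.
Qed.

Let fima_le_meas pi v : measurable [set w | fima pi w <= v].
Proof. by apply: measurable_set_bool; exact: measurable_fun_ler. Qed.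

Let GE pi v : (G pi v)%:E = P2 [set w | fima pi w <= v].
Proof. by rewrite fineK// fin_num_measure. Qed.

Let G_homo pi : {homo G pi : x y / x <= y}.
Proof.
move=> x y xy; rewrite -lee_fin !GE; apply: le_measure; rewrite ?inE//.
by move=> w /=; move=> /le_trans; apply.
Qed.

Let G_large pi : exists v, alpha <= G pi v.
Proof.
apply: contrapT => nG.
suff : (P2 (\bigcup_(k : nat) [set w | (fima pi w <= k%:R)%R]) <= alpha%:E)%E.
  rewrite (_ : \bigcup_k _ = setT).
    by rewrite probability_setT lee_fin leNgt; case/andP : alpha_01 => _ ->.
  apply/seteqP; split => w //= _; exists (Num.truncn (fima pi w)).+1 => //=.
  exact/ltW/truncnS_gt.
apply: measure_bigcup_le => // [k l kl|k].
  by apply/subsetPset => w /= /le_trans; apply; rewrite ler_nat.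
by rewrite /= -GE lee_fin leNgt; apply/negP => /ltW h; apply: nG; exists k%:R.
Qed.

(** The countable intersection makes the coverage event measurable, and bounds on it the left limit
    of [G] at theta0, that is P(theta_hat < theta0), by alpha. *)
Let coveredE : covered =
  \bigcap_(k : nat) [set w | G (pihat w) (theta0 - k.+1%:R^-1) < alpha].
Proof.
have th0 : 0 < theta0 by case/andP : theta0_01.
apply/seteqP; split => w /=.
  by move/(le_quantile (@G_homo _) (G_large _) th0) => h k _; exact: h.
by move=> h; apply/(le_quantile (@G_homo _) (G_large _) th0) => k; exact: h.
Qed.

Let measV : measurable_fun setT V.
Proof.
apply: measurable_funD; last exact: measurable_funM.
apply: (@measurable_hits _ _ _ _ _ (fun i => X i : T1 -> R)) => //.
by apply: measurable_set_bool; exact: measurable_fun_eqr.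
Qed.

Let covered_meas : measurable covered.
Proof.
rewrite coveredE; apply: bigcapT_measurable => k.
set v := theta0 - _.
have mpi : measurable_fun setT pihat.
  rewrite (_ : pihat = fun w => n%:R^-1 * V w).
    by apply: measurable_funM => //; exact: measV.
  by apply/funext => w; rewrite -pihatE mulKf// gt_eqF.
have mG : measurable_fun setT (fun pi => (G pi v)%:E).
  have mA : measurable [set z : R * T2 | fima z.1 z.2 <= v].
    by apply: measurable_set_bool; exact: measurable_fun_ler.
  have := measurable_fun_xsection P2 mA.
  congr (measurable_fun _ _); apply/funext => pi; rewrite GE /=; congr (P2 _).
  by apply/seteqP; split => w; rewrite /xsection/= inE.
apply: measurable_set_bool; apply: measurable_fun_ltr => //.
apply: (measurableT_comp (f := fun pi => G pi v)) => //.
exact/measurable_EFinP.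
Qed.

(** * Exceptional events: large noise and counts near the edges *)

Let m : R := binmax theta0 n.

Context (K : nat) (eta : R).
Hypothesis tail_eta : (muZ [set z | (K%:R <= `|eps^-1 * z|)%R] <= eta%:E)%E.

Let tail_meas : measurable [set z : R | K%:R <= `|eps^-1 * z|].
Proof.
apply: measurable_set_bool; apply: measurable_fun_ler => //.
by apply: measurableT_comp => //; exact: measurable_funM.
Qed.

(** The edges remove 2K + 1 low and 2K high counts, and 4K + 1 is rounded up to 4(K + 1); eta
    accounts for the noise. *)
Let beta : R := eta + 4 * K.+1%:R * m.

(* Outside [bad1] and [bad2], n theta_tilde lies in [1, n), so that the
   conventions for the order statistics of index 0 and n + 1 play no role. *)
Let bad1 : set T1 := [set w | (S w < 2 * K + 1)%N] `|`
  ([set w | (n < S w + 2 * K)%N] `|` Z @^-1` [set z | K%:R <= `|eps^-1 * z|]).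

Let X_prob i : P1 [set w | X i w == 1] = theta0%:E.
Proof.
have [+ _] := X_law i; congr (P1 _ = _).
by apply/seteqP; split => w /= /eqP.
Qed.

Let meas1 : measurable [set x : R | x == 1].
Proof. by apply: measurable_set_bool; exact: measurable_fun_eqr. Qed.

Let S_meas (Q : pred nat) : measurable [set w | Q (S w)].
Proof.
have -> : [set w | Q (S w)] =
    \bigcup_(k in [set k | Q k]) [set w | (S w)%:R == k%:R :> R].
  apply/seteqP; split => w /=; first by exists (S w) => /=.
  by move=> [k Qk /=]; rewrite eqr_nat => /eqP ->.
apply: bigcup_measurable => k _; apply: measurable_set_bool.
apply: measurable_fun_eqr => //.
exact: (@measurable_hits _ _ _ _ _ (fun i => X i : T1 -> R)).
Qed.

Let bad1_meas : measurable bad1.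
Proof.
apply: measurableU; first exact: (S_meas (fun s => (s < 2 * K + 1)%N)).
apply: measurableU; first exact: (S_meas (fun s => (n < s + 2 * K)%N)).
exact: (measurable_funPTI Z).
Qed.

Let bad1_prob : (P1 bad1 <= beta%:E)%E.
Proof.
apply: (le_trans (measureU2 P1 (S_meas (fun s => (s < 2 * K + 1)%N)) _)).
  apply: measurableU; first exact: (S_meas (fun s => (n < s + 2 * K)%N)).
  exact: (measurable_funPTI Z).
have h1 := hits_low meas1 data_indep X_prob (2 * K + 1).
have h2 := hits_high meas1 data_indep X_prob (2 * K).
have h3 := measureU2 P1 (S_meas (fun s => (n < s + 2 * K)%N))
  (measurable_funPTI Z tail_meas).
have h4 : (P1 (Z @^-1` [set z | (K%:R <= `|eps^-1 * z|)%R]) <= eta%:E)%E.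
  by rewrite Z_law.
apply: (le_trans (leeD h1 (le_trans h3 (leeD h2 h4)))).
rewrite -!EFinD lee_fin natrD !natrM /beta -/m -natr1.
have := binmax_ge0 theta0 n; rewrite -/m.
have : 0 <= K%:R :> R by [].
nra.
Qed.

(** D lies in [0, 1] only almost surely, so the null event that it does not is put here. *)
Let bad2 : set T2 := Zs @^-1` [set z | K%:R <= `|eps^-1 * z|] `|`
  Dv @^-1` (~` `[0, 1]%classic).

Let bad2_meas : measurable bad2.
Proof.
apply: measurableU; first exact: (measurable_funPTI Zs).
by apply: (measurable_funPTI Dv); exact: measurableC.
Qed.

Let bad2_prob : (P2 bad2 <= eta%:E)%E.
Proof.
have mD : measurable (~` `[0, 1]%classic : set R) by exact: measurableC.
have h1 : (P2 (Zs @^-1` [set z | (K%:R <= `|eps^-1 * z|)%R]) <= eta%:E)%E.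
  by rewrite Zs_law.
have h2 : P2 (Dv @^-1` (~` `[0, 1]%classic)) = 0%E.
  by rewrite D_law// probability_setC// D_supp subee.
have h3 : (P2 bad2 <= P2 (Zs @^-1` [set z | (K%:R <= `|eps^-1 * z|)%R]) +
    P2 (Dv @^-1` (~` `[0%R, 1%R]%classic)))%E.
  exact: (measureU2 P2 (measurable_funPTI Zs tail_meas) (measurable_funPTI Dv mD)).
by apply: (le_trans h3); rewrite h2 adde0.
Qed.

(** Of the margin 2K in [bad1], one K absorbs the noise of the data here; the other is left for the
    simulated noise in [x_range]. *)
Let good1P w : ~ bad1 w -> K.+1%:R <= V w /\ V w + K%:R <= n%:R.
Proof.
move=> nbad; have [h1 [h2 h3]] :
    (2 * K + 1 <= S w)%N /\ (S w + 2 * K <= n)%N /\ `|eps^-1 * Z w| < K%:R.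
  split; [|split].
  - by rewrite leqNgt; apply/negP => h; apply: nbad; left.
  - by rewrite leqNgt; apply/negP => h; apply: nbad; right; left.
  - by rewrite ltNge; apply/negP => h; apply: nbad; right; right.
move: h1 h2 h3; rewrite -!(ler_nat R) ltr_norml !natrD -natr1 /V.
by move=> h1 h2 /andP[]; lra.
Qed.

Let good2P w : ~ bad2 w -> `|eps^-1 * Zs w| < K%:R /\ 0 <= Dv w <= 1.
Proof.
move=> nbad; split.
  by rewrite ltNge; apply/negP => h; apply: nbad; left.
apply: contrapT => h; apply: nbad; right => /=.
by rewrite in_itv/=.
Qed.

(** * From the fiducial draw to the noisy count of uniforms *)

Section MatchingBounds.
Variables (pi : R) (a : pred R).
Hypothesis a_down : forall x y, x <= y -> a y -> a x.
Hypothesis a_meas : measurable [set x | a x].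
Hypothesis pi_lo : K.+1%:R <= n%:R * pi.
Hypothesis pi_hi : n%:R * pi + K%:R <= n%:R.

Let x_range w : ~ bad2 w ->
  1 <= n%:R * (pi - n%:R^-1 / eps * Zs w) < n%:R.
Proof.
move=> /good2P[h _]; rewrite mulrBr -!mulrA mulVKf ?gt_eqF//.
by move: h pi_lo pi_hi; rewrite ltr_norml -natr1 => /andP[]; lra.
Qed.

Let fima_meas : measurable [set w | a (fima pi w)].
Proof. by have := meas_fima_pi pi measurableT a_meas; rewrite setTI. Qed.

Lemma measurable_Vs : measurable_fun setT (Vs a).
Proof.
apply: measurable_funD; last exact: measurable_funM.
exact: (@measurable_hits _ _ _ _ _ (fun i => U i : T2 -> R)).
Qed.

(** Outside [bad2], [fima_value_ge] applies with x equal to n pi minus the simulated noise; moving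
    the noise to the other side gives [Vs]. The next lemma uses [fima_value_le] in the same way. *)
Lemma fima_prob_le : (P2 [set w | a (fima pi w)] <=
  P2 [set w | (n%:R * pi - 1 < Vs a w)%R] + eta%:E)%E.
Proof.
have mV2 : measurable [set w | n%:R * pi - 1 < Vs a w].
  by apply: measurable_set_bool; apply: measurable_fun_ltr => //; exact: measurable_Vs.
apply: (le_trans _ (leeD2l _ bad2_prob)).
apply: (le_trans _ (measureU2 P2 mV2 bad2_meas)).
apply: le_measure; rewrite ?inE//; first exact: measurableU.
move=> w /= aw; have [bw|nbw] := pselect (bad2 w); [by right|left].
have := fima_value_ge a_down n0 erefl (x_range nbw) (good2P nbw).2 aw.
rewrite /Vs mulrBr -!mulrA mulVKf ?gt_eqF//.
lra.
Qed.

Lemma fima_prob_ge : (P2 [set w | (n%:R * pi < Vs a w)%R] <=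
  P2 [set w | a (fima pi w)] + eta%:E)%E.
Proof.
have mV2 : measurable [set w | n%:R * pi < Vs a w].
  by apply: measurable_set_bool; apply: measurable_fun_ltr => //; exact: measurable_Vs.
apply: (le_trans _ (leeD2l _ bad2_prob)).
apply: (le_trans _ (measureU2 P2 fima_meas bad2_meas)).
apply: le_measure; rewrite ?inE//; first exact: measurableU.
move=> w /= aw; have [bw|nbw] := pselect (bad2 w); [by right|left].
have := @fima_value_le _ n delta pi (n%:R^-1 / eps * Zs w) (Dv w) _
  (fun i => U i w) a a_down n0 erefl (x_range nbw) (good2P nbw).2.
apply; move: aw; rewrite /Vs mulrBr -!mulrA mulVKf ?gt_eqF//.
lra.
Qed.

End MatchingBounds.

Let le_prob i : P2 [set w | U i w <= theta0] = theta0%:E.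
Proof.
rewrite -(uniform01_itv false (U_law i) theta0_01); congr (P2 _).
Qed.

Let lt_prob i : P2 [set w | U i w < theta0] = theta0%:E.
Proof.
rewrite -(uniform01_itv true (U_law i) theta0_01); congr (P2 _).
Qed.

(** A uniform satisfies [a] with the success probability theta0 of the data, and the noises share
    the law [muZ], so both sides are the same binomial mixture. *)
Let Vs_law (a : pred R) (A : set R) : measurable [set x | a x] ->
  (forall i, P2 [set w | a (U i w)] = theta0%:E) -> measurable A ->
  P2 [set w | A (Vs a w)] = P1 [set w | A (V w)].
Proof.
move=> ma aU mA; rewrite (noisy_hits_law meas1 data_indep X_prob _ Z_law mA).
exact: (noisy_hits_law ma (mutually_independent_sim_data sim_indep) aU _ Zs_law mA).
Qed.

Let gt_meas (x : R) : measurable [set y : R | x < y].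
Proof. by apply: measurable_set_bool; exact: measurable_fun_ltr. Qed.

Let V_conc t : (P1 [set w | (t - 1 < V w <= t)%R] <= m%:E)%E.
Proof. exact: (noisy_hits_concentration meas1 data_indep X_prob _ Z_law). Qed.

Let V_gt_meas x : measurable [set w | x < V w].
Proof. by apply: measurable_set_bool; exact: measurable_fun_ltr. Qed.

Let V_ge_meas x : measurable [set w | x <= V w].
Proof. by apply: measurable_set_bool; exact: measurable_fun_ler. Qed.

(** If V >= x0, the survival function at V is at most u, so shifting its argument by one unit and
    adding the exceptional mass keeps P(theta_hat <= theta0) below alpha, which forces coverage. The
    event V >= x0 has probability at least u. *)
Lemma coverage_lower u : 0 < u < 1 -> u + m + eta < alpha ->
  (u%:E <= P1 covered + beta%:E)%E.
Proof.
move=> u01 u_alpha.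
have [x0 [x0P x0_ge _]] := survival_quantile measV u01 V_conc.
apply: (le_trans x0_ge); apply: (le_trans _ (leeD2l _ bad1_prob)).
apply: (le_trans _ (measureU2 P1 covered_meas bad1_meas)).
apply: le_measure; rewrite ?inE//; first exact: measurableU.
move=> w /= x0V; have [bw|nbw] := pselect (bad1 w); [by right|left].
have [lo hi] := good1P nbw; rewrite -pihatE in lo hi.
rewrite coveredE => k _ /=.
(* Coverage concerns only points below theta0; by monotonicity the value at theta0 bounds them
   all. *)
apply: (@le_lt_trans _ _ (G (pihat w) theta0)).
  by apply: G_homo; rewrite lerBlDr lerDl invr_ge0.
rewrite -lte_fin; apply: (@le_lt_trans _ _ (u + m + eta)%:E); last by rewrite lte_fin.
pose a (x : R) := x <= theta0.
have a_down x y : x <= y -> a y -> a x by exact: le_trans.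
have ma : measurable [set x | a x].
  by apply: measurable_set_bool; exact: measurable_fun_ler.
rewrite GE EFinD; apply: (le_trans (fima_prob_le a_down ma lo hi)).
rewrite leeD2r// (Vs_law ma le_prob (gt_meas _)) pihatE.
have mint : measurable [set w' | V w - 1 < V w' <= V w].
  apply: measurable_set_bool; apply: measurable_and.
    exact: measurable_fun_ltr.
  exact: measurable_fun_ler.
apply: (@le_trans _ _ (P1 ([set w' | V w < V w'] `|` [set w' | V w - 1 < V w' <= V w]))).
  apply: le_measure; rewrite ?inE; [exact: V_gt_meas|exact: measurableU|].
  by move=> w' /= h; case: (ltP (V w) (V w')) => h'; [left|right; rewrite h].
apply: (le_trans (measureU2 P1 (V_gt_meas _) mint)).
by rewrite EFinD; apply: leeD; [exact/x0P|exact: V_conc].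
Qed.

(** Conversely, coverage bounds P(theta_hat < theta0) by alpha, hence the survival function at V by
    alpha + eta. This means V >= x0, an event of probability at most alpha + eta + m. *)
Lemma coverage_upper : 0 < eta -> alpha + eta < 1 ->
  (P1 covered <= (alpha + eta + m + beta)%:E)%E.
Proof.
move=> eta0 alpha_eta.
have u01 : 0 < alpha + eta < 1.
  by rewrite alpha_eta andbT; case/andP : alpha_01 => ? _; exact: addr_gt0.
have [x0 [x0P _ x0_le]] := survival_quantile measV u01 V_conc.
rewrite EFinD; apply: (le_trans _ (leeD x0_le bad1_prob)).
apply: (le_trans _ (measureU2 P1 (V_ge_meas _) bad1_meas)).
apply: le_measure; rewrite ?inE//; first exact: measurableU.
move=> w cw; have [bw|nbw] := pselect (bad1 w); [by right|left => /=].
have [lo hi] := good1P nbw; rewrite -pihatE in lo hi.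
apply/x0P.
(* The inequality is strict because coverage controls only the left limit of [G] at theta0. *)
pose a (x : R) := x < theta0.
have a_down x y : x <= y -> a y -> a x by exact: le_lt_trans.
have ma : measurable [set x | a x].
  by apply: measurable_set_bool; exact: measurable_fun_ltr.
have := fima_prob_ge a_down ma lo hi.
rewrite (Vs_law ma lt_prob (gt_meas _)) pihatE => /le_trans; apply.
rewrite EFinD leeD2r//.
have -> : [set w' | a (fima (pihat w) w')] =
    \bigcup_(k : nat) [set w' | fima (pihat w) w' <= theta0 - k.+1%:R^-1].
  apply/seteqP; split => w' /=.
    move=> h; apply: contrapT => nw.
    move: h; rewrite /a ltNge => /negP; apply.
    apply: ler_subr_natinv => k; rewrite ltNge; apply/negP => h'.
    by apply: nw; exists k.
  by move=> [k _ /= /le_lt_trans]; apply; rewrite ltrBlDr ltrDl invr_gt0.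
apply: measure_bigcup_le => // [k l kl|k].
  apply/subsetPset => w' /= /le_trans; apply.
  by rewrite lerD2l lerN2 lef_pV2 ?posrE// ler_nat ltnS.
rewrite /= -GE lee_fin; apply: ltW.
by move: cw; rewrite coveredE => /(_ k I).
Qed.

End FixedSampleSize.

(** * Passage to the limit in the sample size *)

Theorem theorem1 (R : realType) (theta0 eps alpha delta : R)
  (h_theta0 : 0 < theta0 < 1) (h_eps : 0 < eps) (h_alpha : 0 < alpha < 1)
  (h_delta : 0 < delta < 2^-1)
  (muZ muD : probability R R)
  (h_Zint : muZ.-integrable setT (fun z => z%:E))
  (h_Zmean : (\int[muZ]_z z%:E = 0)%E)
  (h_Zvar : (\int[muZ]_z (z ^+ 2)%:E = 1)%E)
  (h_Dsupp : muD `[0, 1]%classic = 1%E)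
  (d1 : measure_display) (T1 : nat -> measurableType d1)
  (P1 : forall n, probability (T1 n) R)
  (X : forall n, 'I_n -> {mfun T1 n >-> R}) (Z : forall n, {mfun T1 n >-> R})
  (h_data_indep : forall n,
     mutually_independent (P1 n) (data_family (Z n) (fun i => X n i : T1 n -> R)))
  (h_X : forall n (i : 'I_n), bernoulli_rv (P1 n) (X n i) theta0)
  (h_Z : forall n, has_law (P1 n) (Z n) muZ)
  (d2 : measure_display) (T2 : nat -> measurableType d2)
  (P2 : forall n, probability (T2 n) R)
  (Zs : forall n, {mfun T2 n >-> R}) (U : forall n, 'I_n -> {mfun T2 n >-> R})
  (Dv : forall n, {mfun T2 n >-> R})
  (h_sim_indep : forall n,
     mutually_independent (P2 n)
       (sim_family (Zs n) (fun i => U n i : T2 n -> R) (Dv n)))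
  (h_Zs : forall n, has_law (P2 n) (Zs n) muZ)
  (h_U : forall n (i : 'I_n), uniform01_rv (P2 n) (U n i))
  (h_D : forall n, has_law (P2 n) (Dv n) muD) :
  (* conditional cdf  v |-> P(theta_hat <= v | pi_hat = pi) *)
  let G := fun (n : nat) (pi v : R) =>
    fine (P2 n [set w | fima_value delta pi ((n%:R^-1 / eps) * Zs n w)
                          (fun i => U n i w) (Dv n w) <= v]) in
  (* conditional alpha-quantile *)
  let q := fun (n : nat) (pi : R) => inf [set v : R | alpha <= G n pi v] in
  (fun n : nat => fine (P1 n [set w | theta0 <=
      q n (sample_prop (fun i => X n i : T1 n -> R) w
           + (n%:R^-1 / eps) * Z n w)])) @ \oo --> alpha.
Proof.
move=> G q; apply/cvgrPdist_lt => e e0.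
move: (h_alpha) => /andP[a0 a1].
(* Once m and C m are below eta, [beta] is below 2 eta, and the coverage lies between alpha - 5 eta
   and alpha + 5 eta. The other two terms of the minimum keep the levels alpha - 3 eta and alpha +
   eta inside (0, 1). *)
pose eta := Num.min e (Num.min alpha (1 - alpha)) / 8.
have eta0 : 0 < eta by rewrite divr_gt0// !lt_min e0 a0 subr_gt0.
have [eta_e eta_a eta_a1] :
    [/\ 8 * eta <= e, 8 * eta <= alpha & 8 * eta <= 1 - alpha].
  have eta8 : 8 * eta = Num.min e (Num.min alpha (1 - alpha)).
    by rewrite /eta mulrC divfK ?pnatr_eq0.
  by rewrite eta8 !ge_min !lexx !orbT.
(* The noise law does not depend on n, so K and C are fixed before n grows and C m(n) still tends to
   0. *)
have [K tailK] := tail_small muZ eps^-1 eta0.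
pose C : R := 4 * K.+1%:R.
have C1 : 1 <= C by rewrite /C -natrM ler1n.
near=> n.
have n0 : (0 < n)%N by near: n; exact: nbhs_infty_gt.
have m0 := binmax_ge0 theta0 n.
have Cm : C * binmax theta0 n < eta.
  have : `|0 - binmax theta0 n| < eta / C.
    near: n; move/cvgrPdist_lt : (cvg_binmax h_theta0); apply.
    by rewrite divr_gt0// (lt_le_trans ltr01).
  by rewrite sub0r normrN ger0_norm// ltr_pdivlMr ?(lt_le_trans ltr01)// mulrC.
have m_eta : binmax theta0 n < eta by nra.
(* One eta pays for m, one for the simulated exceptional event, and the third makes the inequality
   strict with room to spare. *)
have u01 : 0 < alpha - 3 * eta < 1 by apply/andP; split; lra.
have u_alpha : alpha - 3 * eta + binmax theta0 n + eta < alpha by lra.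
have lo := coverage_lower delta h_theta0 h_alpha n0 h_Dsupp (h_data_indep n) (h_X n)
  (h_Z n) (h_sim_indep n) (h_Zs n) (h_U n) (h_D n) tailK u01 u_alpha.
have a_eta : alpha + eta < 1 by lra.
have hi := coverage_upper delta h_theta0 h_alpha n0 h_Dsupp (h_data_indep n) (h_X n)
  (h_Z n) (h_sim_indep n) (h_Zs n) (h_U n) (h_D n) tailK eta0 a_eta.
rewrite -/C in lo hi.
rewrite /q /G; move: lo hi; set p := P1 n _ => lo hi.
have p_fin : p \is a fin_num.
  by rewrite ge0_fin_numE ?measure_ge0// (le_lt_trans hi)// ltry.
move: lo hi; rewrite -(fineK p_fin) -EFinD !lee_fin => lo hi.
rewrite fineK// ltr_norml; apply/andP; split; lra.
Unshelve. all: by end_near.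
Qed.
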